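(* Let $\sigma : A \to A^+$ be a substitution. Then the substitution subshift $(X_{\sigma},T)$ is minimal if and only if it is linearly repetitive.
   Context: An alphabet $A$ is a finite set with at least two elements (one-letter alphabets are excluded); its elements are letters. $A^+$ is the set of all words over $A$ of positive finite length, $\epsilon$ is the empty word, $A^* = A^+ \cup \{\epsilon\}$, and $|w|$ is the length of $w$. A word $v$ is a subword (factor) of $w$ if $w = u v u'$ for some $u,u' \in A^*$. A map $\sigma : A \to A^+$ extends to $\sigma : A^* \to A^*$ by concatenation and $\sigma(\epsilon)=\epsilon$. Put $A_l := \{a \in A : \lim_{n\to\infty} |\sigma^n(a)| = \infty\}$ and $A_s := A \setminus A_l$. A letter $b \in A$ is isolated if $b \in A_s$ and $b$ does not appear in any $\sigma^n(a)$ with $a \in A_l$, $n \ge 1$; $A_{\mathrm{iso}}$ is the set of isolated letters. $\sigma$ is called a substitution if $A_l \ne \emptyset$ and $A_{\mathrm{iso}} = \emptyset$. The language $\mathcal{L}(\sigma) \subseteq A^*$ is the set of all words that are subwords of $\sigma^n(a)$ for some $a \in A$ and $n \ge 1$. For $x \in A^{\mathbb{Z}}$ and integers $s \le t$, $x[s,t] := x(s)x(s+1)\cdots x(t)$. Define $X_\sigma := \{x \in A^{\mathbb{Z}} : x[s,t] \in \mathcal{L}(\sigma) \text{ for all integers } s<t\}$. $T : A^{\mathbb{Z}} \to A^{\mathbb{Z}}$ is the left shift; a subshift is a closed set $\Lambda \subseteq A^{\mathbb{Z}}$ (product topology) with $T(\Lambda)=\Lambda$, written $(\Lambda,T)$.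 A subshift is minimal if it contains no nonempty proper subshift. For a subshift $\Lambda$, $\mathcal{L}(\Lambda)$ is the set consisting of $\epsilon$ and all words $x[s,t]$ with $x \in \Lambda$ and integers $s<t$. A subshift $(\Lambda,T)$ is linearly repetitive if there exists a constant $C>0$ such that for all $v,w \in \mathcal{L}(\Lambda)$ with $|w| \ge C|v|$, the number of occurrences of $v$ in $w$ is at least $1$ (i.e. $v$ is a factor of $w$). *)

(* Defs.v *)
From HB Require Import structures.
From mathcomp Require Import all_boot all_order all_algebra.
From mathcomp Require Import all_classical all_reals topology.

Set Implicit Arguments.
Unset Strict Implicit.
Unset Printing Implicit Defensive.

Import Order.TTheory GRing.Theory Num.Theory.

Local Open Scope classical_set_scope.
Local Open Scope ring_scope.

Section Words.
Variables (A : finType) (sigma : A -> seq A).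

Definition extend (w : seq A) : seq A := flatten (map sigma w).

Definition image_iter (n : nat) (a : A) : seq A := iter n extend [:: a].

Definition long_letters : set A :=
  [set a | (fun n => size (image_iter n a)) @ \oo --> \oo].

Definition short_letters : set A := ~` long_letters.

Definition isolated_letters : set A :=
  [set b | short_letters b /\
     forall a n, long_letters a -> (1 <= n)%N -> b \notin image_iter n a].

Definition substitution : Prop :=
  [/\ forall a, sigma a != [::],
      long_letters !=set0
    & isolated_letters = set0].

Definition language : set (seq A) :=
  [set w | exists a n, (1 <= n)%N /\ infix w (image_iter n a)].

End Words.

Definition biinfinite (A : finType) : topologicalType :=
  {ptws int -> discrete_topology A}.

Section Subshifts.
Variable A : finType.

Definition shift (x : biinfinite A) : biinfinite A := fun i => x (i + 1).

(* The word x(s) x(s+1) ... x(t); only meaningful when s <= t. *)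
Definition window (x : biinfinite A) (s t : int) : seq A :=
  [seq x (s + k%:Z) | k <- iota 0 `|t - s|%N.+1].

Record subshift := Subshift {
  carrier :> set (biinfinite A);
  subshift_closed : closed carrier;
  subshift_shift : shift @` carrier = carrier
}.

Definition minimal (L : subshift) : Prop :=
  forall M : subshift, M `<=` L -> M !=set0 -> M = L :> set (biinfinite A).

Definition subshift_language (L : subshift) : set (seq A) :=
  [set w | w = [::] \/
     exists (x : biinfinite A) (s t : int), [/\ carrier L x, s < t & w = window x s t]].

Definition linearly_repetitive (R : realType) (L : subshift) : Prop :=
  exists2 C : R, 0 < C &
    forall v w : seq A, subshift_language L v -> subshift_language L w ->
      C * (size v)%:R <= (size w)%:R -> infix v w.

End Subshifts.

Section SubstitutionSubshift.
Variables (A : finType) (sigma : A -> seq A).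

Definition X_set : set (biinfinite A) :=
  [set x | forall s t : int, s < t -> language sigma (window x s t)].

Lemma X_set_closed : closed X_set.
Proof.
move=> x clx s t st.
pose I := [seq s + k%:Z | k <- iota 0 `|t - s|%N.+1].
have near_eq (J : seq int) : nbhs x [set y : biinfinite A | {in J, y =1 x}].
  elim: J => [|i J IH]; first by apply: filterS filterT => y _ j.
  have Hi : nbhs x [set y : biinfinite A | y i = x i].
    exact: (@proj_continuous int (fun=> discrete_topology A) i x _
      (discrete_set1 (x i))).
  apply: filterS (filterI IH Hi) => y [yJ yi] j.
  by rewrite inE => /orP[/eqP-> //|]; exact: yJ.
have [y [Xy yI]] := clx _ (near_eq I).
have -> : window x s t = window y s t.
  by apply/eq_in_map => k kI; rewrite yI //; apply/mapP; exists k.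
exact: Xy.
Qed.

Lemma X_set_shift : @shift A @` X_set = X_set.
Proof.
apply/seteqP; split=> [_ [x Xx <-]|x Xx].
  move=> s t st.
  have -> : window (shift x) s t = window x (s + 1) (t + 1).
    rewrite /window /shift opprD addrACA subrr addr0.
    by apply: eq_map => k; rewrite addrAC.
  by apply: Xx; rewrite ltrD2r.
exists (fun i => x (i - 1)); last by apply: funext => i; rewrite /shift addrK.
move=> s t st.
have -> : window (fun i => x (i - 1)) s t = window x (s - 1) (t - 1).
  rewrite /window opprD addrACA subrr addr0.
  by apply: eq_map => k; rewrite addrAC.
by apply: Xx; rewrite ltrD2r.
Qed.

Definition substitution_subshift : subshift A :=
  Subshift X_set_closed X_set_shift.

End SubstitutionSubshift.

(* Main.v *)
Require Import Defs.
From mathcomp Require Import all_boot all_order all_algebra.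
From mathcomp Require Import all_classical all_reals topology.
From mathcomp Require Import zify.

(**
If the subshift X of a substitution is linearly repetitive, every nonempty
subshift M of X contains all words of X in its points, so M, being closed, is X.

Conversely let X be minimal.  By compactness every word of X occurs in all
sufficiently long words of the language of sigma.  Call a letter bounded when
the lengths of its iterated images are.

If X contains an unbounded letter c, put l(n) = |sigma^n(c)|.  For every letter
d of X, |sigma^n(d)| is at most a constant times l(n).  Given a word v of X,
take n least with |v| < l(n).  Then v is covered by the sigma^n-image of a word
u of X whose length is bounded independently of v, because the letters strictly
inside u cannot include c.  A word w of X that is long relative to v contains
sigma^n(z) for a word z of X long enough to contain u, hence w contains v.

If all letters of X are bounded, the images sigma^n(a) contain arbitrarily long
runs of bounded letters.  Such runs can only be created by a letter a with
sigma^k(a) = p a s, or sigma^k(a) = s a p, with s a nonempty word of bounded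
letters.  Then s, sigma^k(s), sigma^2k(s), ... is an eventually periodic
sequence of words whose concatenations are in the language, so X contains a
periodic point, and X is its orbit.
*)

Set Implicit Arguments.
Unset Strict Implicit.
Unset Printing Implicit Defensive.

Import Order.TTheory GRing.Theory Num.Theory.

Local Open Scope classical_set_scope.

(** * Points and words of subshifts *)

Section Points.
Variable A : finType.
Implicit Types (x y z : biinfinite A) (u v w : seq A) (F : set (seq A)).

(** Start and length, rather than two endpoints, allow empty words and make concatenation
    additive. *)
Definition word x (s : int) (n : nat) : seq A :=
  mkseq (fun k => x (s + k%:Z)%R) n.

Definition factor_closed F := forall u w, infix u w -> F w -> F u.

Definition shift_of F : set (biinfinite A) :=
  [set x | forall s n, F (word x s n)].

Lemma size_word x s n : size (word x s n) = n.
Proof. exact: size_mkseq. Qed.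

Lemma windowE x s t : window x s t = word x s `|t - s|%N.+1.
Proof. by []. Qed.

Lemma word_cat x s m n :
  word x s (m + n) = word x s m ++ word x (s + m%:Z)%R n.
Proof.
rewrite /word /mkseq iotaD map_cat add0n -[X in iota X n]addn0 iotaDl -map_comp.
by congr (_ ++ _); apply: eq_map => k /=; rewrite PoszD addrA.
Qed.

Lemma infix_word x (s t : int) m n :
  (s <= t)%R -> (t + m%:Z <= s + n%:Z)%R -> infix (word x t m) (word x s n).
Proof.
move=> st tm; have [k tE] : exists k : nat, t = (s + k%:Z)%R.
  by exists `|t - s|%N; lia.
have -> : n = k + (m + (n - m - k)) by lia.
by rewrite !word_cat tE infix_infix.
Qed.

Lemma eq_word x y s t n :
  (forall k, k < n -> x (s + k%:Z)%R = y (t + k%:Z)%R) -> word x s n = word y t n.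
Proof. by move=> xy; apply/eq_in_map => k; rewrite mem_iota => /xy. Qed.

Lemma nbhs_agree x (J : seq int) :
  nbhs x [set y : biinfinite A | {in J, y =1 x}].
Proof.
elim: J => [|i J IH]; first by apply: filterS filterT => y _ j.
have Hi : nbhs x [set y : biinfinite A | y i = x i].
  exact: (@proj_continuous int (fun=> discrete_topology A) i x _
    (discrete_set1 (x i))).
apply: filterS (filterI IH Hi) => y [yJ yi] j.
by rewrite inE => /orP[/eqP-> //|]; exact: yJ.
Qed.

Lemma compact_biinfinite : compact [set: biinfinite A].
Proof.
have compA : compact [set: discrete_topology A].
  by apply: finite_compact; exact: (@finite_finset A setT).
have := @tychonoff int (fun=> discrete_topology A) (fun=> setT) (fun=> compA).
by congr compact; apply/seteqP; split.
Qed.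

(** Tychonoff gives a cluster point, which serves as the limit of a subsequence would. *)
Lemma cluster_point (xs : nat -> biinfinite A) : exists z,
  (forall M, closed M -> (forall N, M (xs N)) -> M z) /\
  (forall (J : seq int) N, exists2 m, N <= m & {in J, xs m =1 z}).
Proof.
have [z [_ zcl]] := compact_biinfinite (F := xs @ \oo) _ filterT.
exists z; split=> [M clM Mxs|J N].
  by apply: clM => B; apply: zcl; exists 0 => // m _; exact: Mxs.
have : (xs @ \oo) (xs @` [set m | N <= m]).
  by exists N => // m Nm; exists m.
move=> /zcl /(_ (nbhs_agree z J)) [_ [[m Nm <-]] xmz].
by exists m.
Qed.

Lemma closed_shift_of F : closed (shift_of F).
Proof.
move=> x clx s n.
have [y [Fy xy]] := clx _ (nbhs_agree x [seq (s + k%:Z)%R | k <- iota 0 n]).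
have -> : word x s n = word y s n; last exact: Fy.
by apply: eq_word => k kn; rewrite xy //; apply: map_f; rewrite mem_iota.
Qed.

Lemma shift_shift_of F : @shift A @` shift_of F = shift_of F.
Proof.
have wordD x (d : int) s n : word (fun i => x (i + d)%R) s n = word x (s + d)%R n.
  by apply: eq_word => k _; rewrite addrAC.
apply/seteqP; split=> [_ [x Fx <-] s n|x Fx]; first by rewrite wordD; exact: Fx.
exists (fun i => x (i - 1)%R); last by apply: funext => i; rewrite /shift addrK.
by move=> s n; rewrite wordD; exact: Fx.
Qed.

Definition subshift_of F : subshift A :=
  Subshift (@closed_shift_of F) (@shift_shift_of F).

Lemma subshift_translate (M : subshift A) x (d : int) :
  carrier M x -> carrier M (fun i => x (i + d)%R).
Proof.
have fwd y : carrier M y -> carrier M (fun i => y (i + 1)%R).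
  by move=> My; rewrite -(subshift_shift M); exists y.
have bwd y : carrier M y -> carrier M (fun i => y (i - 1)%R).
  move=> My; have := My; rewrite -{1}(subshift_shift M) => -[z Mz zy].
  by rewrite (_ : (fun _ => _) = z) // -zy; apply: funext => i; rewrite /shift subrK.
have ext y z : y =1 z -> carrier M y -> carrier M z by move=> /funext ->.
move=> Mx; case: d => n; elim: n => [|n IH].
- by apply: ext Mx => i; rewrite addr0.
- by apply: ext (fwd _ IH) => i; congr x; lia.
- by apply: ext (bwd _ Mx) => i; congr x; lia.
- by apply: ext (bwd _ IH) => i; congr x; lia.
Qed.

(** Translates of the points [y] agree with [x] on the windows from -N to N; their cluster point is
    [x], and [M] is closed. *)
Lemma subshift_approx (M : subshift A) x :
  (forall s n, exists2 y, carrier M y & exists t, word x s n = word y t n) -> carrier M x.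
Proof.
move=> Mx.
have /choice[xs xsP] : forall N : nat, exists y,
    carrier M y /\ word x (- N%:Z)%R (2 * N).+1 = word y (- N%:Z)%R (2 * N).+1.
  move=> N; have [y My [t ->]] := Mx (- N%:Z)%R (2 * N).+1.
  exists (fun i => y (i + (t + N%:Z))%R); split; first exact: subshift_translate.
  by apply: eq_word => k _; congr y; lia.
have [z [zM zxs]] := cluster_point xs.
suff -> : x = z by apply: zM => [|N]; [exact: subshift_closed|case: (xsP N)].
apply: funext => i; have [m im xsz] := zxs [:: i] `|i|%N.
rewrite -xsz ?inE //; have [_ /(congr1 (nth (x i) ^~ `|(i + m%:Z)%R|%N))] := xsP m.
rewrite !nth_mkseq; [|lia|lia].
by rewrite (_ : (_ + _)%R = i); last lia.
Qed.

(* With [u] empty, this gives a point as soon as [F] has arbitrarily long words. *)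
Lemma exists_point F u : factor_closed F ->
  (forall N, exists p q, [/\ N <= size p, N <= size q & F (p ++ u ++ q)]) ->
  exists2 x, shift_of F x & word x 0%R (size u) = u.
Proof.
move=> facF /choice[p /choice[q pqP]].
have [a0 _] : exists a : A, True.
  by have [] := pqP 1; case: (p 1) => // a; exists a.
pose W N := p N ++ u ++ q N.
pose xs N : biinfinite A := fun i => nth a0 (W N) `|((size (p N))%:Z + i)%R|%N.
have xsE N (s : int) n : (0 <= (size (p N))%:Z + s)%R ->
    (s + n%:Z <= (size u + size (q N))%:Z)%R ->
    word (xs N) s n = take n (drop `|((size (p N))%:Z + s)%R|%N (W N)).
  move=> s0 sn; have szW : `|((size (p N))%:Z + s)%R|%N + n <= size (W N).
    by rewrite /W !size_cat; lia.
  apply: (@eq_from_nth _ a0); rewrite size_word.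
    by rewrite size_takel // size_drop; lia.
  move=> k kn; rewrite nth_mkseq // nth_take // nth_drop /xs.
  by congr nth; lia.
have [z [_ zxs]] := cluster_point xs.
have zE s n N : exists2 m, N <= m & word z s n = word (xs m) s n.
  have [m Nm mz] := zxs [seq (s + k%:Z)%R | k <- iota 0 n] N.
  exists m => //; apply: eq_word => k kn.
  by rewrite mz //; apply: map_f; rewrite mem_iota.
exists z => [s n|].
  have [m Nm ->] := zE s n (`|s|%N + n); have [pm qm Fm] := pqP m.
  rewrite xsE; [|lia|lia]; apply: facF Fm.
  exact: infix_trans (infix_take _ _) (infix_drop _ _).
have [m _ ->] := zE 0%R (size u) 0.
by rewrite xsE ?addr0 ?add0r //=; [rewrite drop_size_cat // take_size_cat|lia].
Qed.

End Points.

(** * Images of words under morphisms *)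

Lemma finite_uniform (T : finType) (P : T -> nat -> Prop) :
  (forall t m n, m <= n -> P t m -> P t n) -> (forall t, exists n, P t n) ->
  exists n, forall t, P t n.
Proof.
move=> monP /choice[f fP]; exists (\max_t f t) => t.
exact: monP (leq_bigmax t) (fP t).
Qed.

Lemma eq_cat_prefix (T : Type) (x y z t : seq T) :
  x ++ y = z ++ t -> size x <= size z -> exists2 r, z = x ++ r & y = r ++ t.
Proof.
elim: x z => [|a x IH] [|b z] //=; [by move=> -> _; exists [::] | |].
  by move=> -> _; exists (b :: z).
by case=> -> /IH{}IH /IH[r -> ->]; exists r.
Qed.

Section Extend.
Variable A : finType.
Implicit Types (tau : A -> seq A) (u v w : seq A).

Lemma extend_cat tau u v : extend tau (u ++ v) = extend tau u ++ extend tau v.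
Proof. by rewrite /extend map_cat flatten_cat. Qed.

Lemma extend_cons tau a u : extend tau (a :: u) = tau a ++ extend tau u.
Proof. by []. Qed.

Lemma extend1 tau a : extend tau [:: a] = tau a.
Proof. by rewrite extend_cons cats0. Qed.

Lemma infix_extend tau u v : infix u v -> infix (extend tau u) (extend tau v).
Proof. by move=> /infixP[p [q ->]]; rewrite !extend_cat infix_infix. Qed.

Lemma infix_extend_mem tau a w : a \in w -> infix (tau a) (extend tau w).
Proof. by rewrite -infix1s => /(infix_extend tau); rewrite extend1. Qed.

Lemma leq_size_extend tau w : (forall a, tau a != [::]) ->
  size w <= size (extend tau w).
Proof.
move=> ne; elim: w => //= a w IH; rewrite extend_cons size_cat.
by rewrite -add1n leq_add // lt0n size_eq0 ne.
Qed.

Lemma size_bound tau : exists L, forall a, size (tau a) <= L.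
Proof.
exists (\max_a size (tau a)) => a.
exact: (leq_bigmax (F := fun a => size (tau a)) a).
Qed.

Lemma size_extend_leq tau w L : (forall a, a \in w -> size (tau a) <= L) ->
  size (extend tau w) <= L * size w.
Proof.
elim: w => //= a w IH wL; rewrite extend_cons size_cat mulnS leq_add //.
  by apply: wL; rewrite mem_head.
by apply: IH => b bw; apply: wL; rewrite inE bw orbT.
Qed.

Lemma extend_split tau w k : k < size (extend tau w) -> exists p a q,
  w = p ++ a :: q /\
  size (extend tau p) <= k < size (extend tau p) + size (tau a).
Proof.
elim: w k => // a w IH k; rewrite extend_cons size_cat => kw.
have [ka|ak] := ltnP k (size (tau a)); first by exists [::], a, w.
have [|p [b [q [-> pk]]]] := IH (k - size (tau a)); first by lia.
by exists (a :: p), b, q; split=> //; rewrite extend_cons size_cat; lia.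
Qed.

(** Only the images of the end letters may stick out of [w]; those of the inner word [v] lie inside
    it, which relates the lengths of [v] and [w]. *)
Definition covers tau u w :=
  (exists2 a, u = [:: a] & infix w (tau a)) \/
  exists (a : A) v (b : A) (s p : seq A), [/\ u = a :: v ++ [:: b], suffix s (tau a),
    prefix p (tau b) & w = s ++ extend tau v ++ p].

Lemma covers_infix tau u w : covers tau u w -> infix w (extend tau u).
Proof.
case=> [[a -> ?]|[a [v [b [s [p [-> /suffixP[s' sE] /prefixP[p' pE] ->]]]]]]].
  by rewrite extend1.
rewrite extend_cons extend_cat extend1 sE pE.
apply/infixP; exists s', p'; by rewrite !catA.
Qed.

(** Cut [U] at the letters whose images contain the first and the last letter of [w]. The two bounds
    make long contexts of [w] come from long contexts of [u]. *)
Lemma coversP tau w U P Q L : (forall a, size (tau a) <= L) ->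
  extend tau U = P ++ w ++ Q -> w != [::] -> exists p u q,
  [/\ U = p ++ u ++ q, covers tau u w,
      size P <= L * (size p).+1 & size Q <= L * (size q).+1].
Proof.
move=> tauL UE w0; have w_gt0 : 0 < size w by rewrite lt0n size_eq0.
have szL z : size (extend tau z) <= L * size z by exact: size_extend_leq.
have szU : size (extend tau U) = size P + (size w + size Q) by rewrite UE !size_cat.
have [|p [a [q [UE1 /andP[pP Pp]]]]] := @extend_split tau U (size P); first by lia.
rewrite {}UE1 extend_cat in UE szU *; rewrite size_cat in szU.
have [P' PE {}UE] := eq_cat_prefix UE pP.
have szP : size P = size (extend tau p) + size P' by rewrite PE size_cat.
have [|p' [b [q' [qE /andP[p'w wp']]]]] :=
  @extend_split tau (a :: q) (size P' + size w).-1; first by lia.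
have Pp1 : size P <= L * (size p).+1 by have := szL p; have := tauL a; lia.
case: p' qE p'w wp' => [|a' v] [aE qE] p'w wp'.
  move: wp'; rewrite -{}aE /= -/(size _) => wp'.
  exists p, [:: a], q; split=> //.
    left; exists a => //; move: UE; rewrite extend_cons catA => /esym UE.
    have [|r -> _] := eq_cat_prefix UE; first by rewrite size_cat; lia.
    by rewrite -catA infix_infix.
  have := szL q; move: (congr1 size UE).
  by rewrite extend_cons !size_cat; have := tauL a; lia.
move: p'w wp'; rewrite -{}aE extend_cons size_cat => p'w wp'.
exists p, (a :: v ++ [:: b]), q'; split => //; first by rewrite qE /= -catA.
  move: UE; rewrite qE !extend_cons extend_cat extend_cons => /esym UE.
  have [|s aE {}UE] := eq_cat_prefix UE; first by lia.
  move: wp' p'w; rewrite aE size_cat => wp' p'w.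
  rewrite catA in UE; have [|t wE {}UE] := eq_cat_prefix (esym UE).
    by rewrite size_cat; lia.
  have [|r bE _] := eq_cat_prefix (esym UE).
    by move: wp'; rewrite wE !size_cat; lia.
  right; exists a, v, b, s, t; split=> //; last by rewrite wE catA.
    by rewrite aE suffix_suffix.
  by rewrite bE prefix_prefix.
move: (szL q') (tauL b) szU; rewrite qE extend_cons extend_cat extend_cons !size_cat.
by lia.
Qed.

End Extend.

(** * Words occurring in points of the substitution subshift *)

Section PointLanguage.
Variable A : finType.
Implicit Types (x y z : biinfinite A) (u v w : seq A) (F : set (seq A)).

(** Possibly smaller than [F], whose words need not extend to a point. *)
Definition point_language F : set (seq A) :=
  [set u | exists x s n, shift_of F x /\ u = word x s n].

Lemma point_language_sub F : point_language F `<=` F.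
Proof. by move=> _ [x [s [n [Fx ->]]]]. Qed.

Lemma infix_wordP x s n u :
  infix u (word x s n) -> exists t, u = word x t (size u).
Proof.
move=> /infixP[p [q]] wE; exists (s + (size p)%:Z)%R.
have /(congr1 size) := wE; rewrite size_word !size_cat => nE.
move: wE; rewrite nE !word_cat => /eqP.
rewrite eqseq_cat ?size_word // => /andP[_].
by rewrite eqseq_cat ?size_word // => /andP[/eqP].
Qed.

Lemma point_language_factor F : factor_closed (point_language F).
Proof.
move=> u w uw [x [s [n [Fx wE]]]]; rewrite wE in uw.
by have [t uE] := infix_wordP uw; exists x, t, (size u).
Qed.

Lemma subshift_languageP (S : subshift A) F w : carrier S = shift_of F ->
  subshift_language S w -> w = [::] \/ point_language F w.
Proof.
move=> SE [->|[x [s [t [Sx _ ->]]]]]; first by left.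
by right; exists x, s, `|t - s|%N.+1; rewrite -SE.
Qed.

(** The bound [E] serves all words of [F], even those in no point, so it applies to the iterated
    images themselves. *)
Lemma minimal_recurrent (S : subshift A) F u :
  carrier S = shift_of F -> factor_closed F -> minimal S ->
  point_language F u ->
  exists E, forall w, F w -> E <= size w -> infix u w.
Proof.
move=> SE facF minS [y [s [n [Fy uE]]]].
apply: contrapT => noE.
(* Otherwise the points of S avoiding u form a nonempty proper subshift. *)
pose G : set (seq A) := [set w | F w /\ ~~ infix u w].
have facG : factor_closed G.
  move=> v w vw [Fw uw]; split; first exact: facF Fw.
  by apply: contra uw => /infix_trans; apply.
have [N|x Gx _] := @exists_point A G [::] facG.
  apply: contrapT => noN; apply: noE; exists (N + N) => w Fw Nw.
  apply: contrapT => /negP uw; apply: noN; exists (take N w), (drop N w).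
  by rewrite size_drop cat_take_drop size_takel; [split=> //; lia|lia].
have GS : carrier (subshift_of G) `<=` carrier S.
  by move=> z Gz; rewrite SE => t k; case: (Gz t k).
have GE := minS (subshift_of G) GS (ex_intro _ x Gx).
have : carrier (subshift_of G) y by rewrite GE SE.
by move=> /(_ s n)[_]; rewrite -uE infix_refl.
Qed.

End PointLanguage.

Section Language.
Variables (A : finType) (sigma : A -> seq A).
Implicit Types (u v w : seq A) (a : A).

Lemma iter_extend n w : iter n (extend sigma) w = extend (image_iter sigma n) w.
Proof.
elim: w => [|a w IH]; first by elim: n => //= n ->.
rewrite extend_cons -IH -cat1s /image_iter.
by elim: n {IH} => //= n ->; rewrite extend_cat.
Qed.

Lemma image_iterD m n a :
  image_iter sigma (m + n) a = extend (image_iter sigma m) (image_iter sigma n a).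
Proof. by rewrite /image_iter iterD iter_extend. Qed.

Lemma image_iter1 a : image_iter sigma 1 a = sigma a.
Proof. exact: extend1. Qed.

Lemma image_iterSr n a :
  image_iter sigma n.+1 a = extend (image_iter sigma n) (sigma a).
Proof. by rewrite -addn1 image_iterD image_iter1. Qed.

Lemma language_factor : factor_closed (language sigma).
Proof.
move=> u w uw [a [n [n1 wa]]]; exists a, n; split=> //.
exact: infix_trans wa.
Qed.

Lemma language_image_iter n a : 0 < n -> language sigma (image_iter sigma n a).
Proof. by move=> n0; exists a, n; rewrite infix_refl. Qed.

Lemma X_setE : X_set sigma = shift_of (language sigma).
Proof.
apply/seteqP; split=> x Xx s.
  (* Windows have at least two letters, so a window of length [n + 2] is used to reach every [n]. *)
  move=> n; apply: language_factor (Xx s (s + n.+1%:Z)%R _); last by lia.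
  by rewrite windowE; apply: infix_word; lia.
by move=> t st; rewrite windowE; exact: (Xx s).
Qed.

(** A factor of sigma^m(a) with m > n lies in sigma^n(sigma^(m-n)(a)); the finitely many m <= n give
    words of bounded length only. *)
Lemma language_desubstitution n : exists B, forall w,
  language sigma w -> B <= size w ->
  exists2 U, language sigma U & infix w (extend (image_iter sigma n) U).
Proof.
have [|B nB] := @finite_uniform 'I_n.+1 (fun i B => forall a,
    size (image_iter sigma i a) <= B) _ (fun i => size_bound _).
  by move=> i k l kl ik a; exact: leq_trans kl.
exists B.+1 => w [a [m [_ wa]]] Bw.
have [mn|nm] := leqP m n; last first.
  exists (image_iter sigma (m - n) a).
    by apply: language_image_iter; rewrite subn_gt0.
  by rewrite -image_iterD subnKC // ltnW.
have := leq_trans Bw (size_infix wa); rewrite ltnNge.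
by rewrite (nB (Ordinal (mn : m < n.+1))).
Qed.

Hypothesis sigma_ne : forall a, sigma a != [::].

Lemma extend_ne (tau : A -> seq A) w :
  (forall a, tau a != [::]) -> w != [::] -> extend tau w != [::].
Proof.
by move=> tau_ne; rewrite -!size_eq0 -!lt0n => /leq_trans; apply; exact: leq_size_extend.
Qed.

Lemma image_iter_ne n a : image_iter sigma n a != [::].
Proof. by elim: n => //= n; exact: extend_ne. Qed.

Lemma size_image_iter_mono m n a : m <= n ->
  size (image_iter sigma m a) <= size (image_iter sigma n a).
Proof.
move=> /subnK <-; rewrite image_iterD; apply: leq_size_extend.
exact: image_iter_ne.
Qed.

Lemma covers_size (tau : A -> seq A) u w : (forall a, tau a != [::]) ->
  covers tau u w -> size u <= (size w).+2.
Proof.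
move=> tau_ne; case=> [[a -> _] //|[a [v [b [s [p [-> _ _ ->]]]]]]].
by have := leq_size_extend v tau_ne; rewrite /= !size_cat /=; lia.
Qed.

(** A preimage in the language is not enough, as [u] must occur in a point. Desubstituting longer
    and longer surroundings of [w] gives covers with arbitrarily long contexts on both sides. *)
Lemma point_desubstitution n w : w != [::] ->
  point_language (language sigma) w ->
  exists2 u, point_language (language sigma) u & covers (image_iter sigma n) u w.
Proof.
move=> w0 [x [s [k [Xx wE]]]]; set tau := image_iter sigma n.
have [B Bdes] := language_desubstitution n.
have [L tauL] := size_bound tau.
have cov N : exists p u q, [/\ N <= size p, N <= size q, covers tau u w
    & language sigma (p ++ u ++ q)].
  (* The summand [L * N] forces contexts of length [N] in the preimage; [B] makes desubstitution
     possible. *)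
  pose M := (L * N + B).+1.
  have [|U LU] := Bdes _ (Xx (s - M%:Z)%R (M + (k + M))).
    by rewrite size_word /M; lia.
  rewrite !word_cat subrK -wE => /infixP[P [Q UE]].
  have [|p [u [q [pE cu pP qQ]]]] := @coversP _ tau w U (P ++ word x (s - M%:Z)%R M)
      (word x (s + k%:Z)%R M ++ Q) L tauL _ w0.
    by rewrite UE !catA.
  exists p, u, q; rewrite -pE; split=> //; rewrite leqNgt; apply/negP => ltN.
    have : L * (size p).+1 <= L * N by rewrite leq_mul2l ltN orbT.
    by move: pP; rewrite size_cat size_word /M; lia.
  have : L * (size q).+1 <= L * N by rewrite leq_mul2l ltN orbT.
  by move: qQ; rewrite size_cat size_word /M; lia.
(* The covers have bounded length, so one of them occurs for arbitrarily large N. *)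
apply: contrapT => nou.
have [u||N NP] := @finite_uniform ((size w).+2.-bseq A)
    (fun (u : (size w).+2.-bseq A) N => forall p q,
    N <= size p -> N <= size q -> covers tau u w -> ~ language sigma (p ++ u ++ q)).
- by move=> m N mN H p q Np Nq; apply: H; exact: leq_trans mN _.
- move=> u; apply: contrapT => noN; apply: nou; exists (u : seq A).
    have [N|x' Xx' <-] := @exists_point A (language sigma) u language_factor.
      apply: contrapT => nopq; apply: noN; exists N => p q Np Nq _ Lpq.
      by apply: nopq; exists p, q.
    by exists x', 0%R, (size u).
  by apply: contrapT => nc; apply: noN; exists 0 => p q _ _ /nc.
have [p [u [q [Np Nq cu Lpq]]]] := cov N.
by apply: (NP (Bseq (covers_size (image_iter_ne n) cu)) p q).
Qed.

End Language.

(** * Minimal subshifts with an unbounded letter *)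

Section LongCase.
Variables (A : finType) (sigma : A -> seq A).
Hypothesis sigma_ne : forall a, sigma a != [::].

Definition bounded_letter (a : A) : Prop :=
  exists S, forall n, size (image_iter sigma n a) <= S.

Definition linear_recurrence (F : set (seq A)) := exists C, forall v w,
  point_language F v -> point_language F w -> v != [::] ->
  C * size v <= size w -> infix v w.

Lemma unbounded_letterP a : ~ bounded_letter a ->
  forall B, exists n, B < size (image_iter sigma n a).
Proof.
move=> una B; apply: contrapT => non; apply: una; exists B => n.
by rewrite leqNgt; apply/negP => ?; apply: non; exists n.
Qed.

Lemma linear_recurrence_long (S : subshift A) c :
  carrier S = shift_of (language sigma) -> minimal S ->
  point_language (language sigma) [:: c] -> ~ bounded_letter c ->
  linear_recurrence (language sigma).
Proof.
move=> SE minS Xc unc.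
have rec u := minimal_recurrent (u := u) SE (@language_factor A sigma) minS.
pose ell n := size (image_iter sigma n c).
have [L sigmaL] := size_bound sigma.
have ellS n : ell n.+1 <= L * ell n by exact: size_extend_leq.
(* Words of length [E] contain [c]; from length [E1] on they contain every letter of the points, and
   from [E2] on every word of the points of length at most [E + 1]. *)
have [E cE] := rec _ Xc.
have [d m n mn H Xd w Lw nw|d|E1 allE1] := @finite_uniform A (fun d N =>
    point_language (language sigma) [:: d] ->
    forall w, language sigma w -> N <= size w -> d \in w).
- by apply: H => //; exact: leq_trans mn nw.
- have [Xd|nXd] := pselect (point_language (language sigma) [:: d]); last by exists 0.
  by have [N dN] := rec _ Xd; exists N => _ w Lw Nw; rewrite -infix1s dN.
have [K0 K0E] := unbounded_letterP unc E1.
(* The successor makes the exponent positive, as [language] requires. *)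
pose K := K0.+1.
have [C1 KC1] := size_bound (image_iter sigma K).
have C1P n d : point_language (language sigma) [:: d] ->
    size (image_iter sigma n d) <= C1 * ell n.
  (* [d] occurs in sigma^K(c), so sigma^n(d) is a factor of sigma^K(sigma^n(c)). *)
  move=> Xd; have dK : d \in image_iter sigma K c.
    apply: allE1 => //; first exact: language_image_iter.
    by apply: leq_trans (ltnW K0E) _; exact: size_image_iter_mono.
  apply: leq_trans (size_infix (infix_extend_mem (image_iter sigma n) dK)) _.
  by rewrite -image_iterD addnC image_iterD; exact: size_extend_leq.
have [u m n mn H Xu w Lw nw|u|E2 allE2] := @finite_uniform (E.+1.-bseq A)
    (fun (u : E.+1.-bseq A) N => point_language (language sigma) u ->
    forall w, language sigma w -> N <= size w -> infix u w).
- by apply: H => //; exact: leq_trans mn nw.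
- have [Xu|nXu] := pselect (point_language (language sigma) u); last by exists 0.
  by have [N uN] := rec _ Xu; exists N => _.
(* If the cover of [w] had fewer than [E2 + 2] letters, [w] would have length at most
   [C1 * L * E2.+2] times that of [v]. The 2 counts the end letters of the cover. *)
exists (C1 * L * E2.+2).+1 => v w Xv Xw v0 Cvw.
have v_gt0 : 0 < size v by rewrite lt0n size_eq0.
have [n vn ellv] : exists2 n, size v < ell n & ell n <= L * size v.
  (* The least such [n] is positive because [ell 0] is 1; minimality and [ellS] bound [ell n]. *)
  case: (ex_minnP (unbounded_letterP unc (size v))) => -[|n] vn nmin.
    by move: vn; rewrite ltnS leqNgt v_gt0.
  exists n.+1 => //; apply: leq_trans (ellS n) _; rewrite leq_mul2l orbC leqNgt.
  by rewrite (contraNN (nmin n)) // ltnn.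
set tau := image_iter sigma n.
have [u Xu cu] := point_desubstitution sigma_ne n v0 Xv.
(* An inner word of length at least [E] would contain [c], and its image would be longer than
   [v]. *)
have size_u : size u <= E.+1.
  move: Xu; case: cu => [[a -> //]|[a [z [b [s [p [-> _ _ vE]]]]]]] Xu.
  rewrite leqNgt; apply/negP => szz.
  have Xz : point_language (language sigma) z.
    apply: point_language_factor Xu; apply/infixP.
    by exists [:: a], [:: b].
  have : infix [:: c] z.
    apply: cE; first exact: point_language_sub Xz.
    by move: szz; rewrite /= size_cat /=; lia.
  rewrite infix1s => /(infix_extend_mem tau)/size_infix zn.
  have {}zn : ell n <= size (extend (image_iter sigma n) z) := zn.
  by move: vn; rewrite vE !size_cat; lia.
have w0 : w != [::] by rewrite -size_eq0 -lt0n; apply: leq_trans Cvw; rewrite muln_gt0.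
have [u' Xu' cu'] := point_desubstitution sigma_ne n w0 Xw.
have size_u' : E2.+2 <= size u'.
  rewrite leqNgt; apply/negP => u'E; move: Cvw; apply/negP; rewrite -ltnNge.
  apply: leq_ltn_trans (size_infix (covers_infix cu')) _.
  have /leq_ltn_trans -> // : size (extend tau u') <= (C1 * ell n) * size u'.
    apply: size_extend_leq => d; rewrite -infix1s => du'.
    by apply: C1P; exact: point_language_factor Xu'.
  have : C1 * ell n * size u' <= C1 * (L * size v) * E2.+2.
    by rewrite leq_mul // ?leq_mul // ltnW.
  by nia.
case: cu' Xu' size_u' => [[a -> //]|[a [z [b [s [p [-> _ _ wE]]]]]]] Xu' szz.
have Xz : point_language (language sigma) z.
  by apply: point_language_factor Xu'; apply/infixP; exists [:: a], [:: b].
have uz : infix u z.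
  apply: (allE2 (Bseq size_u)) => //; first exact: point_language_sub Xz.
  by move: szz; rewrite /= size_cat /=; lia.
rewrite wE; apply: infix_trans (infix_infix _ _ _).
exact: infix_trans (covers_infix cu) (infix_extend tau uz).
Qed.

End LongCase.

(** * Minimal subshifts without unbounded letters *)

Lemma finite_collision (T : finType) (f : nat -> T) :
  exists i j, i < j /\ f i = f j.
Proof.
apply: contrapT => nof.
have injf : injective (fun i : 'I_#|T|.+1 => f i).
  move=> i j fij; apply: val_inj; case: (ltngtP i j) => // ij; case: nof.
    by exists i, j.
  by exists j, i.
by have := leq_card _ injf; rewrite card_ord ltnn.
Qed.

(** * Minimal subshifts containing a periodic point *)

Section Periodic.
Variable A : finType.
Implicit Types (F : set (seq A)) (y : seq A).

(** The powers of [y] put the bi-infinite repetition [z] of [y] into [S], so by minimality all words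
    of points are words of [z]. *)
Lemma linear_recurrence_periodic (S : subshift A) F y :
  carrier S = shift_of F -> minimal S -> factor_closed F -> y != [::] ->
  (forall m, F (flatten (nseq m y))) -> linear_recurrence F.
Proof.
move=> SE minS facF y0 yF; have y_gt0 : 0 < size y by rewrite lt0n size_eq0.
have [a _] : exists a : A, True by case: y y0 {y_gt0 yF} => // a; exists a.
pose z : biinfinite A := fun i => nth a y `|(i %% (size y)%:Z)%Z|%N.
have zper (q s : int) n : word z (q * (size y)%:Z + s)%R n = word z s n.
  by apply: eq_word => k _; rewrite /z -addrA modzMDl.
have zy m : word z 0%R (m * size y) = flatten (nseq m y).
  elim: m => [|m IH]; first by rewrite mul0n.
  rewrite mulSn word_cat [flatten _]/= -IH.
  congr (_ ++ _); last by rewrite add0r -(zper 1%R 0%R) mul1r addr0.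
  apply: (@eq_from_nth _ a); rewrite size_word // => k ky.
  by rewrite nth_mkseq // /z add0r modz_small //; lia.
have zF s n : F (word z s n).
  rewrite -(zper (Posz `|s|%N)); apply: facF (yF (`|s|%N + n + `|s|%N)).
  by rewrite -zy; apply: infix_word; nia.
pose G : set (seq A) := [set w | exists s n, w = word z s n].
have GS : carrier (subshift_of G) `<=` carrier S.
  by move=> x Gx; rewrite SE => s n; have [t [m ->]] := Gx s n.
have Gz : carrier (subshift_of G) z by move=> s n; exists s, n.
have GE := minS (subshift_of G) GS (ex_intro _ z Gz).
have FG w : point_language F w -> exists s, w = word z s (size w).
  move=> [x [s [n [Fx ->]]]].
  have : carrier (subshift_of G) x by rewrite GE SE.
  by move=> /(_ s n)[t [m wE]]; exists t; rewrite {1}wE wE size_word.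
(* Modulo the period, [v] occurs in [z] less than [size y] places after the start of [w]; as [v] is
   nonempty, [size y + size v] is at most [(size y).+1 * size v]. *)
exists (size y).+1 => v w /FG[j vE] /FG[i wE] v0 vw.
have v_gt0 : 0 < size v by rewrite lt0n size_eq0.
have jE := divz_eq (j - i)%R (size y)%:Z.
have r0 : (0 <= modz (j - i) (size y)%:Z)%R by rewrite modz_ge0 //; lia.
have r1 : (modz (j - i) (size y)%:Z < (size y)%:Z)%R by rewrite ltz_pmod.
move: jE r0 r1; set q := divz _ _; set r := modz _ _ => jE r0 r1.
rewrite vE wE (_ : j = q * (size y)%:Z + (i + r))%R; last by lia.
by rewrite zper; apply: infix_word; nia.
Qed.

End Periodic.

(** * Runs of bounded letters in iterated images *)

Section BoundedWords.
Variables (A : finType) (sigma : A -> seq A).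
Hypothesis sigma_ne : forall a, sigma a != [::].
Implicit Types (u v w s p : seq A) (a b : A).

Definition bounded_word w := forall a, a \in w -> bounded_letter sigma a.

Lemma bounded_word_infix u w : infix u w -> bounded_word w -> bounded_word u.
Proof. by move=> /mem_infix uw bw a /uw /bw. Qed.

Lemma bounded_word_cat u w :
  bounded_word u -> bounded_word w -> bounded_word (u ++ w).
Proof. by move=> bu bw a; rewrite mem_cat => /orP[/bu|/bw]. Qed.

Lemma bounded_word_extend n w :
  bounded_word w -> bounded_word (extend (image_iter sigma n) w).
Proof.
move=> bw b /flattenP[_ /mapP[a aw ->] ba]; have [B aB] := bw _ aw.
exists B => m; apply: leq_trans (aB (m + n)).
by rewrite image_iterD size_infix // infix_extend_mem.
Qed.

Lemma bounded_letters_uniform : exists B, forall a n,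
  bounded_letter sigma a -> size (image_iter sigma n a) <= B.
Proof.
have [a m n mn H k /(H k) /leq_trans|a|B aB] := @finite_uniform A (fun a B =>
    forall n, bounded_letter sigma a -> size (image_iter sigma n a) <= B).
- exact.
- have [[B aB]|nba] := pselect (bounded_letter sigma a); last by exists 0.
  by exists B.
- by exists B.
Qed.

Lemma bounded_image_iter n a :
  bounded_word (image_iter sigma n a) -> bounded_letter sigma a.
Proof.
move=> bw; have [B aB] := bounded_letters_uniform.
exists (B * size (image_iter sigma n a)) => m.
apply: leq_trans (size_image_iter_mono sigma_ne a (leq_addr n m)) _.
rewrite image_iterD; apply: size_extend_leq => b /bw; exact: aB.
Qed.

Lemma bounded_extend n w :
  bounded_word (extend (image_iter sigma n) w) -> bounded_word w.
Proof.
move=> bw a aw; apply: (@bounded_image_iter n).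
exact: bounded_word_infix (infix_extend_mem _ aw) bw.
Qed.

Lemma last_unbounded w : ~ bounded_word w -> exists p b s,
  [/\ w = p ++ b :: s, ~ bounded_letter sigma b & bounded_word s].
Proof.
elim: w => [[] //|a w IH nbw].
have [bw|/IH[p [b [s [-> nb bs]]]]] := pselect (bounded_word w).
  exists [::], a, w; split=> // ba; apply: nbw => b.
  by rewrite inE => /orP[/eqP ->|/bw].
by exists (a :: p), b, s.
Qed.

Definition tail_free := forall k a p s,
  image_iter sigma k a = p ++ a :: s -> bounded_word s -> s = [::].

(** For unbounded [b], this makes [b] the last unbounded letter of some iterated image of [a]. *)
Definition reaches a b := exists k p s,
  image_iter sigma k a = p ++ b :: s /\ bounded_word s.

Lemma reaches_trans a b c : reaches a b -> reaches b c -> reaches a c.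
Proof.
move=> [k [p [s [aE bs]]]] [l [p' [s' [bE bs']]]].
exists (l + k), (extend (image_iter sigma l) p ++ p'),
  (s' ++ extend (image_iter sigma l) s); split.
  by rewrite image_iterD aE extend_cat extend_cons bE -!catA.
exact: bounded_word_cat bs' (bounded_word_extend bs).
Qed.

(* Write sigma(a) = p b t with b unbounded and t bounded, so that the tail of
   sigma^(n+1)(a) is the tail of sigma^n(b) followed by sigma^n(t).  By
   [tail_free], when t is nonempty b does not reach a, so fewer letters are
   reachable from b than from a; hence t is nonempty at most #|A| times. *)
Lemma bounded_tails : tail_free -> exists K, forall n a s,
  ~ bounded_letter sigma a -> bounded_word s ->
  suffix s (image_iter sigma n a) -> size s <= K.
Proof.
move=> tf; have [B aB] := bounded_letters_uniform.
have [L aL] := size_bound sigma.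
pose R a := #|[pred b | `[< reaches a b >]]|.
have RA a : R a <= #|A| by exact: max_card.
suff H n a s : ~ bounded_letter sigma a -> bounded_word s ->
    suffix s (image_iter sigma n a) -> size s <= B * L * R a.
  exists (B * L * #|A|) => n a s ba bs sa.
  by apply: leq_trans (H _ _ _ ba bs sa) _; rewrite leq_mul2l RA orbT.
elim: n a s => [|n IH] a s ba bs.
  move=> /suffixP[[|c s0] /= sE]; first by case: ba; apply: bs; rewrite -sE mem_head.
  by move/(congr1 size): sE; rewrite /= size_cat; lia.
have nba : ~ bounded_word (sigma a).
  by move=> bw; apply: ba; apply: (@bounded_image_iter 1); rewrite image_iter1.
have [p [b [t [aE nb bt]]]] := last_unbounded nba.
have ab : reaches a b by exists 1, p, t; rewrite image_iter1.
have Rsub : [pred c | `[< reaches b c >]] \subset [pred c | `[< reaches a c >]].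
  by apply/fintype.subsetP => c; rewrite !inE; exact: reaches_trans.
have Rba : R b <= R a by exact: subset_leq_card.
have Rtba : t != [::] -> R b < R a.
  move=> t0; apply: proper_card; apply/fintype.properP; split=> //.
  exists a; rewrite !inE; first by exists 0, [::], [::].
  apply/negP; rewrite inE => -[k [q [r [bE br]]]].
  (* If [b] reached [a], then [a] would recur in sigma^(k+1)(a) followed by a nonempty bounded
     word. *)
  have := @tf k.+1 a (extend (image_iter sigma k) p ++ q)
    (r ++ extend (image_iter sigma k) t).
  rewrite image_iterSr aE extend_cat extend_cons bE -!catA.
  move=> /(_ erefl (bounded_word_cat br (bounded_word_extend bt))).
  move/eqP; rewrite -size_eq0 size_cat addn_eq0 !size_eq0 => /andP[_].
  exact/negP/extend_ne/t0/image_iter_ne.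
set T := extend (image_iter sigma n) t.
have sT : size T <= B * size t by apply: size_extend_leq => c /bt; exact: aB.
have tL : size t <= L by apply: leq_trans (aL a); rewrite aE size_cat /=; lia.
have Rb0 : 0 < R b by apply/card_gt0P; exists b; rewrite inE; exists 0, [::], [::].
rewrite image_iterSr aE extend_cat extend_cons -/T.
rewrite catA => /suffixP[s0 /esym sE].
have [s0X|/ltnW Xs0] := leqP (size s0) (size (extend (image_iter sigma n) p ++
  image_iter sigma n b)); last first.
  have [r _ TE] := eq_cat_prefix (esym sE) Xs0.
  have sT' : size s <= size T by rewrite TE size_cat leq_addl.
  apply: leq_trans sT' (leq_trans sT (leq_trans (leq_mul (leqnn B) tL) _)).
  by rewrite leq_pmulr // (leq_trans Rb0).
have [s' XE s'E] := eq_cat_prefix sE s0X.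
have bs' : bounded_word s'.
  by apply: bounded_word_infix bs; rewrite s'E; apply: prefix_infix.
have s'R : size s' <= B * L * R b.
  apply: (IH b s' nb bs').
  (* The bounded word [s'] cannot contain all of sigma^n(b), as [b] is unbounded; hence it is a
     suffix of sigma^n(b). *)
  have [s0p|/ltnW ps0] := leqP (size s0) (size (extend (image_iter sigma n) p)).
    have [r _ rE] := eq_cat_prefix (esym XE) s0p.
    case: nb; apply: (@bounded_image_iter n); apply: bounded_word_infix bs'.
    by rewrite rE suffix_infix.
  by have [r _ ->] := eq_cat_prefix XE ps0; exact: suffix_suffix.
rewrite s'E size_cat.
have [t0|/Rtba Rlt] := eqVneq t [::].
  have -> : size T = 0 by move: sT; rewrite t0 muln0 leqn0 => /eqP.
  by rewrite addn0 (leq_trans s'R) // leq_mul2l Rba orbT.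
apply: leq_trans (leq_add s'R (leq_trans sT (leq_mul (leqnn B) tL))) _.
by rewrite addnC -mulnS leq_mul2l Rlt orbT.
Qed.

(** Induction on [n] through the cover of [s] by letters of sigma(a). Its two end pieces are bounded
    by [K] or by [B]; its inner letters, at most [L] of them, are bounded and contribute at most
    [B * L]. So the bound does not grow with [n]. *)
Lemma bounded_runs K :
  (forall n a s, ~ bounded_letter sigma a -> bounded_word s ->
    suffix s (image_iter sigma n a) -> size s <= K) ->
  (forall n a s, ~ bounded_letter sigma a -> bounded_word s ->
    prefix s (image_iter sigma n a) -> size s <= K) ->
  exists R, forall n a s, bounded_word s -> infix s (image_iter sigma n a) ->
    size s <= R.
Proof.
move=> sufK preK; have [B aB] := bounded_letters_uniform.
have [L aL] := size_bound sigma.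
exists (1 + 2 * (B + K) + B * L); elim=> [|n IH] a s bs.
  by move=> /size_infix /leq_trans; apply.
have [->//|s0] := eqVneq s [::].
rewrite image_iterSr => /infixP[P [Q sE]].
have [Ln aLn] := size_bound (image_iter sigma n).
have [p [u [q [aE cu _ _]]]] := @coversP _ (image_iter sigma n) s (sigma a) P Q
  Ln aLn sE s0.
have uL : size u <= L.
  by apply: leq_trans (aL a); rewrite aE !size_cat addnCA leq_addr.
case: cu uL => [[b _ sb]|[b [v [c [s1 [s2 [-> s1b s2c sE']]]]]]] uL; first exact: IH sb.
have bs1 : bounded_word s1.
  by apply: bounded_word_infix bs; rewrite sE' prefix_infix.
have bs2 : bounded_word s2.
  by apply: bounded_word_infix bs; rewrite sE' catA suffix_infix.
have bv : bounded_word v.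
  by apply: (@bounded_extend n); apply: bounded_word_infix bs; rewrite sE' infix_infix.
have s1K : size s1 <= B + K.
  have [/aB bB|nb] := pselect (bounded_letter sigma b).
    by apply: leq_trans (leq_addr _ _); exact: leq_trans (size_infix (suffixW s1b)) (bB n).
  by apply: leq_trans (leq_addl _ _); exact: sufK s1b.
have s2K : size s2 <= B + K.
  have [/aB cB|nc] := pselect (bounded_letter sigma c).
    by apply: leq_trans (leq_addr _ _); exact: leq_trans (size_infix (prefixW s2c)) (cB n).
  by apply: leq_trans (leq_addl _ _); exact: preK s2c.
have vB : size (extend (image_iter sigma n) v) <= B * size v.
  by apply: size_extend_leq => d /bv; exact: aB.
have : B * size v <= B * L.
  by rewrite leq_mul2l (leq_trans _ uL) ?orbT //= size_cat; lia.
by rewrite sE' !size_cat; lia.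
Qed.

(** sigma^(mk)(a) ends with a f(0) f(1) ... f(m-1). The words [f i] are bounded in length, so
    [f (i + d) = f i] for some [i] and some [d > 0], and [y] is f(i) ... f(i+d-1). *)
Lemma periodic_of_tail k a p s :
  image_iter sigma k a = p ++ a :: s -> bounded_word s -> s != [::] ->
  exists2 y, y != [::] & forall m, language sigma (flatten (nseq m y)).
Proof.
move=> aE bs s0; have [B aB] := bounded_letters_uniform.
pose f i := extend (image_iter sigma (i * k)) s.
have fB i : size (f i) <= B * size s.
  by apply: size_extend_leq => b /bs; exact: aB.
have [i [d [d0 fid]]] : exists i d, 0 < d /\ f (i + d) = f i.
  have [i [j [ij [fij]]]] := finite_collision (fun i => Bseq (fB i)).
  by exists i, (j - i); rewrite subn_gt0 ij subnKC // ltnW.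
have fD m n : f (m + n) = extend (image_iter sigma (m * k)) (f n).
  by rewrite /f mulnDl -!iter_extend iterD.
have fper n : f (n + i + d) = f (n + i) by rewrite -addnA fD fid -fD.
have fblock m : map f (iota (i + m * d) d) = map f (iota i d).
  elim: m => [|m IH]; first by rewrite addn0.
  rewrite -IH mulSn addnCA iotaDl -map_comp; apply/eq_in_map => n.
  rewrite mem_iota => /andP[/subnK <- _] /=.
  by rewrite addnC addnA (addnAC _ i) fper.
have k0 : 0 < k.
  case: k aE {f fB fid fD fper fblock} => // /(congr1 size).
  by move: s0; rewrite -size_eq0 size_cat /=; lia.
have pow m : exists P,
    image_iter sigma (m * k) a = P ++ a :: flatten (map f (iota 0 m)).
  elim: m => [|m [P PE]]; first by exists [::].
  exists (extend (image_iter sigma (m * k)) p ++ P).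
  rewrite mulSn addnC image_iterD aE extend_cat extend_cons PE.
  by rewrite -addn1 iotaD map_cat flatten_cat /= cats0 -!catA.
exists (flatten (map f (iota i d))) => [|m].
  case: d d0 {fid fper fblock} => // d _ /=.
  have : f i != [::] by apply: extend_ne => // b; exact: image_iter_ne.
  by case: (f i).
have -> : flatten (nseq m (flatten (map f (iota i d)))) =
    flatten (map f (iota i (m * d))).
  elim: m => // m IH; rewrite -addn1 nseqD flatten_cat IH /= cats0.
  by rewrite addn1 mulSn addnC iotaD map_cat flatten_cat fblock.
(* The first [i] blocks precede the periodic part; the successor keeps the exponent positive. *)
have [P PE] := pow (i + m * d).+1.
apply: language_factor (@language_image_iter _ sigma ((i + m * d).+1 * k) a _).
  rewrite PE -addn1 -addnA iotaD iotaD !map_cat !flatten_cat -cat1s add0n.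
  by rewrite !(catA _ _ (_ ++ _ ++ _)) infix_infix.
by rewrite muln_gt0 k0.
Qed.

End BoundedWords.

(** * Reversal of words, and linear recurrence of minimal subshifts *)

Section Mirror.
Variables (A : finType) (sigma : A -> seq A).
Implicit Types (u v w s p : seq A) (a b : A).

(** Reversal exchanges prefixes and suffixes, so the results on bounded tails yield those on bounded
    heads. *)
Definition mirror a := rev (sigma a).

Lemma extend_mirror w : extend mirror w = rev (extend sigma (rev w)).
Proof.
elim: w => // a w IH.
by rewrite extend_cons IH rev_cons -cats1 extend_cat extend1 rev_cat.
Qed.

Lemma image_iter_mirror n a : image_iter mirror n a = rev (image_iter sigma n a).
Proof.
rewrite /image_iter; elim: n => //= n ->.
by rewrite extend_mirror revK.
Qed.

Lemma bounded_letter_mirror a : bounded_letter mirror a <-> bounded_letter sigma a.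
Proof.
by split=> -[B aB]; exists B => n; have := aB n; rewrite image_iter_mirror size_rev.
Qed.

Lemma bounded_word_mirror w : bounded_word mirror w <-> bounded_word sigma (rev w).
Proof.
split=> bw a aw; apply/bounded_letter_mirror/bw; last by rewrite mem_rev.
by rewrite -mem_rev.
Qed.

Lemma language_mirror w : language mirror w -> language sigma (rev w).
Proof.
move=> [a [n [n1]]]; rewrite image_iter_mirror -infix_rev revK => wa.
by exists a, n.
Qed.

Hypothesis sigma_ne : forall a, sigma a != [::].

Lemma mirror_ne a : mirror a != [::].
Proof. by rewrite -size_eq0 size_rev size_eq0. Qed.

Lemma bounded_runs_or_periodic :
  (exists R, forall n a s, bounded_word sigma s ->
     infix s (image_iter sigma n a) -> size s <= R) \/
  exists2 y, y != [::] & forall m, language sigma (flatten (nseq m y)).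
Proof.
have [per|noper] := pselect (exists2 y : seq A, y != [::] &
  forall m, language sigma (flatten (nseq m y))); first by right.
left; have tf : tail_free sigma.
  move=> k a p s aE bs; apply: contrapT => /eqP s0; apply: noper.
  exact: periodic_of_tail aE bs s0.
have tf' : tail_free mirror.
  move=> k a p s aE bs; apply: contrapT => /eqP s0; apply: noper.
  have [y y0 yL] := periodic_of_tail mirror_ne aE bs s0.
  exists (rev y) => [|m]; first by rewrite -size_eq0 size_rev size_eq0.
  by have := language_mirror (yL m); rewrite rev_flatten map_nseq rev_nseq.
have [K sufK] := bounded_tails sigma_ne tf.
have [K' preK] := bounded_tails mirror_ne tf'.
apply: (@bounded_runs _ _ sigma_ne (K + K')) => n a s na bs sa.
  exact: leq_trans (sufK n a s na bs sa) (leq_addr _ _).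
apply: leq_trans (leq_addl _ _); rewrite -size_rev; apply: (preK n a).
- by move/bounded_letter_mirror.
- by apply/bounded_word_mirror; rewrite revK.
- by rewrite image_iter_mirror suffix_rev.
Qed.

Lemma minimal_linear_recurrence (S : subshift A) :
  carrier S = shift_of (language sigma) -> minimal S ->
  linear_recurrence (language sigma).
Proof.
move=> SE minS.
have [[c Xc unc]|nolong] := pselect (exists2 c,
    point_language (language sigma) [:: c] & ~ bounded_letter sigma c).
  exact: linear_recurrence_long SE minS Xc unc.
have [[R boundR]|[y y0 yL]] := bounded_runs_or_periodic; last first.
  exact: linear_recurrence_periodic SE minS (@language_factor _ sigma) y0 yL.
(* Any point would contain a run of [R.+1] bounded letters, so there is none and any constant will
   do. *)
exists 0 => v w [x [s [n [Xx _]]]] _ _ _; exfalso; have [a [m [_ wa]]] := Xx s R.+1.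
have bw : bounded_word sigma (word x s R.+1).
  move=> b bw; apply: contrapT => nb; apply: nolong; exists b => //.
  rewrite -infix1s in bw; apply: point_language_factor bw _.
  by exists x, s, R.+1.
by have := boundR m a _ bw wa; rewrite size_word ltnn.
Qed.

End Mirror.

Theorem corollary3p35 (R : realType) (A : finType) (hA : (1 < #|A|)%N)
  (sigma : A -> seq A) (hsigma : substitution sigma) :
  minimal (substitution_subshift sigma) <->
  linearly_repetitive R (substitution_subshift sigma).
Proof.
have [sigma_ne _ _] := hsigma; set S := substitution_subshift sigma.
have SE : carrier S = shift_of (language sigma) by exact: X_setE.
split=> [/(minimal_linear_recurrence sigma_ne SE)[C CP]|[C C0 CP] M MS [y My]].
  exists C.+1%:R%R; first by rewrite ltr0n.
  move=> v w Sv Sw; rewrite -natrM ler_nat => Cvw.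
  have [->|v0] := eqVneq v [::]; first exact: infix0s.
  have v_gt0 : 0 < size v by rewrite lt0n size_eq0.
  have [vE|Xv] := subshift_languageP SE Sv; first by rewrite vE in v0.
  have [wE|Xw] := subshift_languageP SE Sw; first by move: Cvw; rewrite wE /=; nia.
  by apply: CP => //; apply: leq_trans Cvw; rewrite leq_mul2r leqnSn orbT.
apply/seteqP; split=> // x Sx; apply: subshift_approx => s n; exists y => //.
(* Windows have at least two letters, so [word x s n] is extended by two letters, dropped again at
   the end; [D] makes the word of [y] long enough to contain the extension. *)
pose D := Num.bound (C * n.+2%:R)%R.
have vS : subshift_language S (word x s n.+2).
  by right; exists x, s, (s + n.+1%:Z)%R; split=> //; [lia|rewrite windowE; congr word; lia].
have wS : subshift_language S (word y 0%R D.+2).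
  right; exists y, 0%R, (Posz D.+1); split; [exact: MS|lia|].
  by rewrite windowE; congr word; lia.
have [|t vE] := infix_wordP (CP _ _ vS wS _).
  rewrite !size_word; apply: le_trans (ltW (archi_boundP _)) _.
    by rewrite mulr_ge0 // ltW.
  by rewrite ler_nat -/D; lia.
exists t; move: vE; rewrite size_word -addn2 !word_cat => /eqP.
by rewrite eqseq_cat ?size_word // => /andP[/eqP].
Qed.
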